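(* Let $G=\mathbb{Z}_{p^e}\times\mathbb{Z}_{p^t}$, where $p$ is a prime and $e,t\ge1$. Then: (i) $\mathcal{I}(G)=\Phi(G)$; (ii) the graph $\Delta(G)$ is $r$-regular, where $r=p\,\varphi(p^{e+t-1})$; (iii) the graph $\Delta(G)$ is a complete $(p+1)$-partite graph, isomorphic to $K_{(p+1)\times\varphi(p^{e+t-1})}$. Moreover, $|E(\Delta(G))|=\frac12 p(p+1)\bigl(\varphi(p^{e+t-1})\bigr)^2$.
   Context: The generating graph $\Gamma(G)$ of a group $G$ is the simple graph with vertex set $G$ in which two distinct vertices $x,y$ are adjacent if and only if $\langle x,y\rangle=G$. $\mathcal{I}(G)$ is the set of isolated vertices of $\Gamma(G)$, and $\Delta(G)$ is the subgraph of $\Gamma(G)$ induced by its non-isolated vertices. $E(\cdot)$ denotes the edge set. $\Phi(G)$ is the Frattini subgroup, $\varphi$ the Euler totient function, and $K_{\ell\times s}$ the complete $\ell$-partite graph with all $\ell$ parts of size $s$. *)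

(* Defs.v *)
From mathcomp Require Import all_boot all_order all_algebra.
From mathcomp Require Import all_fingroup all_solvable.

Set Implicit Arguments.
Unset Strict Implicit.
Unset Printing Implicit Defensive.

Record sgraph := SGraph {
  vert :> finType;
  adj : rel vert;
  adj_sym : symmetric adj;
  adj_irr : irreflexive adj
}.

Section Graphs.
Variable H : sgraph.

Definition nbrs (x : H) : {set H} := [set y | adj x y].

Definition isolated : {set H} := [set x | nbrs x == set0].

Definition edges : {set {set H}} :=
  [set [set u.1; u.2] | u : H * H & adj u.1 u.2].

Definition regular (r : nat) : Prop := forall x : H, #|nbrs x| = r.

(* The blocks of a partition are nonempty, so there are exactly k parts. *)
Definition complete_multipartite (k : nat) : Prop :=
  exists P : {set {set H}},
    [/\ partition P [set: H], #|P| = k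
      & forall x y : H, adj x y = (pblock P x != pblock P y)].

Section Induced.
Variable S : {set H}.

Definition ind_adj : rel {x : H | x \in S} := fun x y => adj (val x) (val y).

Lemma ind_adj_sym : symmetric ind_adj.
Proof. by move=> x y; apply: adj_sym. Qed.

Lemma ind_adj_irr : irreflexive ind_adj.
Proof. by move=> x; apply: adj_irr. Qed.

Definition induced : sgraph := SGraph ind_adj_sym ind_adj_irr.

End Induced.
End Graphs.

Definition isomorphic (H K : sgraph) : Prop :=
  exists2 f : H -> K, bijective f & forall x y, adj (f x) (f y) = adj x y.

(* The vertex (i, a) is the a-th vertex of the i-th part. *)
Section CompleteMultipartite.
Variables l s : nat.

Definition Kpart_adj : rel ('I_l * 'I_s) := fun x y => x.1 != y.1.

Lemma Kpart_adj_sym : symmetric Kpart_adj.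
Proof. by move=> x y; rewrite /Kpart_adj eq_sym. Qed.

Lemma Kpart_adj_irr : irreflexive Kpart_adj.
Proof. by move=> x; rewrite /Kpart_adj eqxx. Qed.

Definition Kpart : sgraph := SGraph Kpart_adj_sym Kpart_adj_irr.

End CompleteMultipartite.

Section GeneratingGraph.
Variable gT : finGroupType.

Definition gen_adj : rel gT :=
  fun x y => (x != y) && (<<[set x; y]>>%g == [set: gT]).

Lemma gen_adj_sym : symmetric gen_adj.
Proof. by move=> x y; rewrite /gen_adj eq_sym setUC. Qed.

Lemma gen_adj_irr : irreflexive gen_adj.
Proof. by move=> x; rewrite /gen_adj eqxx. Qed.

Definition Gamma : sgraph := SGraph gen_adj_sym gen_adj_irr.

Definition Delta : sgraph := induced (~: isolated Gamma).

End GeneratingGraph.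

(* Both factors are additive groups and the group law on pairs is componentwise.
   'Z_n is the ring of integers modulo n only for n > 1. *)
Definition ZxZ (p e t : nat) : finGroupType :=
  ('Z_(p ^ e) * 'Z_(p ^ t))%type.

(* Main.v *)
(**
For x outside the Frattini subgroup F of G, let M x be the join of F and <x>.
As G is a p-group with |G| = p^2 |F|, this M x has order p |F|, so it is a
maximal subgroup, and it is the only one containing x. Since F consists of
non-generators, x and y generate G exactly when both lie outside F and
M x <> M y. Hence Delta(G) is complete multipartite with parts M x \ F, each
of size (p - 1) |F|, and the number of parts follows by counting.
*)

Require Import Defs.
From mathcomp Require Import all_boot all_order all_algebra.
From mathcomp Require Import all_fingroup all_solvable.
From mathcomp Require Import ring.

Set Implicit Arguments.
Unset Strict Implicit.
Unset Printing Implicit Defensive.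

(** * Graphs in which adjacency means having different labels, all label classes having size [s] *)

Section MultipartiteByLabel.

Variables (H : sgraph) (rT : finType) (f : H -> rT) (k s : nat).
Hypothesis adj_label : forall x y, adj x y = (f x != f y).
Hypothesis card_fiber : forall x, #|[set y | f y == f x]| = s.
Hypothesis s_gt0 : 0 < s.
Hypothesis card_H : #|H| = k * s.

Let fiber x : {set H} := [set y | f y == f x].

Lemma label_regular : regular H (k.-1 * s).
Proof.
move=> x; rewrite (_ : nbrs x = ~: fiber x); last first.
  by apply/setP=> y; rewrite !inE adj_label eq_sym.
by rewrite cardsCs setCK card_fiber card_H -subn1 mulnBl mul1n.
Qed.

(** The fibers of [f] cut the [k * s] vertices into classes of size [s], and the positive factor [s]
    cancels. *)
Lemma card_labels : #|f @: [set: H]| = k.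
Proof.
apply/eqP; rewrite -(eqn_pmul2r s_gt0) -card_H -cardsT.
rewrite -[#|[set: H]|]sum1_card (partition_big_imset f) /= -sum_nat_const; apply/eqP/esym.
apply: eq_bigr => _ /imsetP[x _ ->]; rewrite -(card_fiber x) -sum1_card.
by apply: eq_bigl => y; rewrite !inE.
Qed.

Lemma label_multipartite : complete_multipartite H k.
Proof.
have ptnP := preim_partitionP f [set: H].
have [/eqP covP tiP _] := and3P ptnP.
exists (preim_partition f [set: H]); split=> //.
- apply/eqP; rewrite -(eqn_pmul2r s_gt0) -card_H -cardsT.
  rewrite -(card_uniform_partition _ ptnP) // => _ /imsetP[x _ ->].
  by rewrite -(card_fiber x); apply: eq_card => y; rewrite !inE eq_sym.
- move=> x y; rewrite adj_label eq_pblock // ?covP ?inE //.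
  rewrite pblock_equivalence_partition ?inE //.
  by move=> a b c _ _ _ /=; split=> // /eqP->.
Qed.

(** A vertex goes to the index of its label among the attained labels, paired with its rank inside
    its own fiber. This map is injective, and both sides have [k * s] vertices. *)
Lemma label_isomorphic : isomorphic H (Kpart k s).
Proof.
have label_ltn x : index (f x) (enum (f @: [set: H])) < k.
  by rewrite -card_labels cardE index_mem mem_enum imset_f ?inE.
have rank_ltn x : index x (enum (fiber x)) < s.
  by rewrite -(card_fiber x) cardE index_mem mem_enum inE.
pose g x : Kpart k s := (Ordinal (label_ltn x), Ordinal (rank_ltn x)).
have eq_label x y : ((g x).1 == (g y).1) = (f x == f y).
  apply/eqP/eqP=> [[] /(index_inj (f x)) eq_ixy | fxy].
    by apply: eq_ixy; rewrite mem_enum imset_f ?inE.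
  by apply: val_inj; rewrite /= fxy.
exists g; last by move=> x y; rewrite adj_label -eq_label.
apply: inj_card_bij => [x y eq_gxy|]; last by rewrite card_prod !card_ord card_H.
have /eqP fxy: f x == f y by rewrite -eq_label eq_gxy.
(* Equal ranks identify the vertices only once both are taken in the same fiber. *)
have eq_fib: fiber x = fiber y by rewrite /fiber fxy.
case: eq_gxy => _; rewrite eq_fib => /(index_inj x); apply;
by rewrite mem_enum inE ?fxy.
Qed.

End MultipartiteByLabel.

(** Both sides count the ordered pairs of adjacent vertices, grouped by underlying edge on the left
    and by first coordinate on the right. *)
Lemma handshake (H : sgraph) : #|edges H| * 2 = \sum_(x : H) #|nbrs x|.
Proof.
pose A := [set u : H * H | adj u.1 u.2].
transitivity #|A|.
  rewrite -[RHS]sum1_card.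
  rewrite (partition_big_imset (fun u : H * H => [set u.1; u.2])) /=.
  rewrite (_ : _ @: A = edges H); last first.
    apply/setP=> E; apply/imsetP/imsetP=> -[u]; rewrite ?inE => uA ->.
      by exists u; rewrite ?inE.
    by exists u; rewrite ?inE.
  rewrite -sum_nat_const; apply: eq_bigr => _ /imsetP[[x y] /= xy ->].
  rewrite inE /= in xy.
  have nxy: x != y by apply: contraTneq xy => ->; rewrite adj_irr.
  (* An edge arises from exactly two ordered pairs, distinct because there are no loops. *)
  rewrite sum1_card (@eq_card _ _ [set (x, y); (y, x)]) ?cards2.
    by rewrite xpair_eqE negb_and nxy.
  case=> a b; rewrite !inE unfold_in /= inE !xpair_eqE; apply/andP/orP=> [[ab]|].
    move=> /eqP eqE; have nab: a != b by apply: contraTneq ab => ->; rewrite adj_irr.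
    have := set21 a b; have := set22 a b; rewrite eqE !inE.
    case/pred2P=> eb; case/pred2P=> ea; rewrite ea eb ?eqxx ?orbT in nab *; by auto.
  by case=> /andP[/eqP-> /eqP->]; rewrite ?xy ?eqxx //=; rewrite adj_sym xy setUC eqxx.
rewrite -sum1_card (eq_bigl (fun u => xpredT u.1 && adj u.1 u.2)).
  rewrite -(pair_big_dep xpredT (fun x y => adj x y) (fun _ _ => 1)) /=.
  by apply: eq_bigr => x _; rewrite sum1_card cardsE.
by move=> u; rewrite inE.
Qed.

(** * Finite p-groups whose Frattini subgroup has index [p ^ 2] *)

Section FrattiniIndex.

Local Open Scope group_scope.

Variables (gT : finGroupType) (p : nat).
Local Notation G := [set: gT].
Hypothesis p_pr : prime p.
Hypothesis pG : p.-group G.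
Hypothesis cardG : #|G| = (p ^ 2 * #|'Phi(G)|)%N.

Let M (x : gT) : {set gT} := 'Phi(G) <*> <[x]>.

Let G_norm_Phi (A : {set gT}) : A \subset 'N('Phi(G)).
Proof. exact: subset_trans (subsetT A) (normal_norm (Phi_normal G)). Qed.

Let card_over_Phi (K : {group gT}) :
  'Phi(G) \subset K -> #|K| = (#|'Phi(G)| * #|K / 'Phi(G)|)%N.
Proof. by move=> sPhiK; rewrite card_quotient // Lagrange. Qed.

(** The quotient by the Frattini subgroup is elementary abelian, so the nontrivial image of [x] has
    order [p] there. *)
Lemma card_Phi_cycle (x : gT) :
  x \notin 'Phi(G) -> #|'Phi(G) <*> <[x]>| = (p * #|'Phi(G)|)%N.
Proof.
move=> xPhi; have nPhi: x \in 'N('Phi(G)) by rewrite -sub1set.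
rewrite card_over_Phi ?joing_subl // mulnC /= quotientYidl ?cycle_subG //.
rewrite quotient_cycle // -orderE.
rewrite (abelem_order_p (Phi_quotient_abelem pG)) ?mem_quotient ?inE //.
by apply: contraNneq xPhi => /coset_idr; apply.
Qed.

Let mem_Phi_cycle (x : gT) : x \in M x.
Proof. by rewrite mem_gen // inE cycle_id orbT. Qed.

(** Since [M x] and [M y] have the same order, the inclusion of [M y] in [M x] is already an
    equality. *)
Lemma Phi_cycle_eq (x y : gT) :
  x \notin 'Phi(G) -> y \notin 'Phi(G) -> (M y == M x) = (y \in M x).
Proof.
move=> xPhi yPhi; apply/eqP/idP=> [<- | yMx].
  exact: mem_Phi_cycle.
apply/eqP; rewrite eqEcard !card_Phi_cycle // leqnn andbT.
by rewrite join_subG joing_subl cycle_subG.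
Qed.

Lemma generates_iff (x y : gT) : x \notin 'Phi(G) -> y \notin 'Phi(G) ->
  (<<[set x; y]>> == [set: gT]) = (M x != M y).
Proof.
move=> xPhi yPhi; have p_gt1 := prime_gt1 p_pr.
have Phi_gt0: 0 < #|'Phi(G)| := cardG_gt0 _.
apply/eqP/idP=> [defG | neqM].
  (* If the labels agree, the generated subgroup lies in [M x], which is too small to be [G]. *)
  apply: contraTneq (leqnn #|G|) => eqM; rewrite -ltnNge {2}cardG.
  apply: (@leq_ltn_trans #|M x|); last first.
    by rewrite card_Phi_cycle // ltn_pmul2r // -{1}(expn1 p) ltn_exp2l.
  have: <<[set x; y]>> \subset M x.
    rewrite gen_subG subUset !sub1set mem_Phi_cycle.
    by rewrite -Phi_cycle_eq // -/(M x) eqM eqxx.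
  by rewrite defG => /subset_leq_card.
(* By the non-generator property it suffices that [K], the join with the Frattini subgroup, is [G].
   It strictly contains [M x], so its quotient has order above [p] and dividing [p ^ 2]. *)
apply: Phi_nongen; apply/eqP; rewrite eqEcard subsetT cardG /=.
set K := ('Phi(G) <*> [set x; y])%G.
have sMK z : z \in [set x; y] -> M z \subset K.
  by move=> xyz; rewrite join_subG joing_subl cycle_subG mem_gen // inE xyz orbT.
have ltpK : (p < #|K / 'Phi(G)|)%N.
  rewrite -(ltn_pmul2l Phi_gt0) -card_over_Phi ?joing_subl // mulnC.
  rewrite -(card_Phi_cycle xPhi) proper_card // properEneq sMK ?set21 // andbT.
  apply: contraNneq neqM => eqMK; rewrite eq_sym Phi_cycle_eq //.
  by rewrite /M eqMK mem_gen // !inE eqxx !orbT.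
have: #|K / 'Phi(G)| %| (p ^ 2)%N.
  rewrite -(@dvdn_pmul2l #|'Phi(G)|) // -card_over_Phi ?joing_subl // mulnC -cardG.
  by rewrite cardSg // subsetT.
case/(dvdn_pfactor _ _ p_pr)=> i le_i2 cardK; rewrite cardK in ltpK.
rewrite -{1}(expn1 p) ltn_exp2l // in ltpK.
rewrite (_ : i = 2) in cardK; last by apply/eqP; rewrite eqn_leq le_i2.
by rewrite (@card_over_Phi K) ?joing_subl // cardK mulnC.
Qed.

(** A Frattini element could be dropped from a generating pair, making [G] cyclic; but every cyclic
    subgroup lies in the Frattini subgroup or in some [M y], both proper. Conversely, [x] outside
    the Frattini subgroup is adjacent to any [y] outside [M x]. *)
Lemma isolated_Phi : isolated (Gamma gT) = 'Phi(G).
Proof.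
have Phi_nonisolated x y :
    <<[set x; y]>> = [set: gT] -> x \notin 'Phi(G).
  move=> defG; apply/negP=> xPhi; have Phi_gt0 := cardG_gt0 'Phi(G).
  have defGy: <<[set y]>> = G.
    apply: Phi_nongen; apply/eqP; rewrite eqEsubset subsetT.
    have: <<[set x; y]>> \subset 'Phi(G) <*> [set y].
      rewrite gen_subG subUset !sub1set (subsetP (joing_subl _ _)) //.
      by rewrite mem_gen // !inE eqxx orbT.
    by rewrite defG.
  have [yPhi | yPhi] := boolP (y \in 'Phi(G)).
    have: <<[set y]>> \subset 'Phi(G) by rewrite gen_subG sub1set.
    rewrite defGy => /subset_leq_card.
    by rewrite leqNgt cardG ltn_Pmull // (ltn_exp2l 0) // prime_gt1.
  have: <<[set y]>> \subset M y by apply: joing_subr.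
  rewrite defGy => /subset_leq_card; rewrite card_Phi_cycle // leqNgt cardG ltn_pmul2r //.
  by rewrite -{1}(expn1 p) ltn_exp2l ?prime_gt1.
apply/setP=> x; rewrite inE; apply/idP/idP=> [isox | xPhi]; last first.
  rewrite -subset0; apply/subsetP=> y; rewrite inE => /andP[_ /eqP/Phi_nonisolated].
  by rewrite xPhi.
apply: contraTT isox => xPhi.
have [y _ yMx]: exists2 y, y \in G & y \notin M x.
  apply/subsetPn/negP=> /subset_leq_card; rewrite card_Phi_cycle // leqNgt cardG.
  by rewrite ltn_pmul2r ?cardG_gt0 // -{1}(expn1 p) ltn_exp2l ?prime_gt1.
have yPhi: y \notin 'Phi(G).
  by apply: contra yMx; apply/subsetP; apply: joing_subl.
apply/set0Pn; exists y; rewrite inE /= /gen_adj generates_iff //.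
rewrite eq_sym [_ == M y]eq_sym Phi_cycle_eq // yMx andbT.
by apply: contraNneq yMx => ->; exact: mem_Phi_cycle.
Qed.

Let lab (x : Delta gT) := M (val x).

Let DeltaP (x : Delta gT) : val x \notin 'Phi(G).
Proof. by rewrite -isolated_Phi -in_setC; apply: (valP x). Qed.

Lemma Delta_adjE (x y : Delta gT) : adj x y = (lab x != lab y).
Proof.
rewrite /= /ind_adj /= /gen_adj (generates_iff (DeltaP x) (DeltaP y)).
(* Different labels already force different vertices. *)
by rewrite andb_idl //; apply: contra_neq; apply: congr1.
Qed.

Lemma card_Delta : #|Delta gT| = (p.+1 * (p.-1 * #|'Phi(G)|))%N.
Proof.
rewrite card_sig /= (eq_card (B := ~: isolated (Gamma gT))) //.
rewrite isolated_Phi cardsCs setCK -cardsT cardG mulnA.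
(* The square [1 ^ 2] puts the count in the shape of a difference of squares. *)
rewrite (_ : p.+1 * p.-1 = p ^ 2 - 1 ^ 2)%N ?mulnBl ?mul1n //.
by rewrite subn_sqr subn1 addn1 mulnC.
Qed.

(** The fiber is [M x] without the Frattini subgroup, as a vertex has the label of [x] exactly when
    it lies in [M x]. *)
Lemma Delta_fiber (x : Delta gT) :
  #|[set y | lab y == lab x]| = (p.-1 * #|'Phi(G)|)%N.
Proof.
rewrite -(card_imset _ val_inj) (_ : _ @: _ = M (val x) :\: 'Phi(G)).
  rewrite cardsD (setIidPr (joing_subl _ _)) card_Phi_cycle //.
  by rewrite -subn1 mulnBl mul1n.
apply/setP=> y; rewrite inE; apply/imsetP/andP=> [[z] | [yPhi yM]].
  by rewrite inE => eqM ->; rewrite -Phi_cycle_eq.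
have yD: y \in ~: isolated (Gamma gT) by rewrite inE isolated_Phi.
exists (exist _ y yD) => //; rewrite inE /lab /=.
by rewrite (Phi_cycle_eq (DeltaP x) yPhi).
Qed.
End FrattiniIndex.

(** * Order and Frattini subgroup of the product of two cyclic p-groups *)

Section ZxZ.

Local Open Scope group_scope.

Variables p e t : nat.
Hypotheses (p_pr : prime p) (e_gt0 : (0 < e)%N) (t_gt0 : (0 < t)%N).
Local Notation G := [set: ZxZ p e t].

Let card_Zpe n : 0 < n -> #|[set: 'Z_(p ^ n)]| = (p ^ n)%N.
Proof.
by move=> n_gt0; rewrite cardsT card_ord Zp_cast // -(exp1n n) ltn_exp2r ?prime_gt1.
Qed.

Lemma card_ZxZ : #|G| = (p ^ (e + t))%N.
Proof. by rewrite cardsT card_prod -!cardsT !card_Zpe // expnD. Qed.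

Lemma ZxZ_pgroup : p.-group G.
Proof. by rewrite /pgroup card_ZxZ pnatX pnat_id. Qed.

(** The group is cyclic on [Zp1], so ['Mho^1] is generated by the p-th power of [Zp1], of order
    [p ^ n] divided by [p]. *)
Let card_Mho_Zpe n : 0 < n -> #|'Mho^1([set: 'Z_(p ^ n)])| = (p ^ n.-1)%N.
Proof.
move=> n_gt0.
have oZ: #[Zp1 : 'Z_(p ^ n)] = (p ^ n)%N by rewrite orderE -Zp_cycle card_Zpe.
rewrite Zp_cycle (@Mho_p_cycle 1 _ p) ?/p_elt ?oZ ?pnatX ?pnat_id //.
rewrite -orderE orderXdiv oZ ?dvdn_exp2l //.
by rewrite -expnB ?(prime_gt0 p_pr) // subn1.
Qed.

(** In an abelian p-group the Frattini subgroup is the set of p-th powers, and powers in a product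
    are taken componentwise. *)
Lemma card_Phi_ZxZ : #|'Phi(G)| = (p ^ (e + t - 2))%N.
Proof.
have abG: abelian G by apply/centsP=> -[a b] _ [c d] _; congr pair; apply: GRing.addrC.
rewrite (Phi_Mho ZxZ_pgroup abG).
have pow2 (x : ZxZ p e t) n : x ^+ n = (x.1 ^+ n, x.2 ^+ n).
  by case: x => a b; elim: n => // n IHn; rewrite !expgS IHn.
have MhoZ n : 0 < n -> 'Mho^1([set: 'Z_(p ^ n)]) = [set x ^+ p | x in [set: 'Z_(p ^ n)]].
  move=> n_gt0; rewrite (@MhoEabelian 1 _ p) //.
  - by rewrite /pgroup card_Zpe // pnatX pnat_id.
  - by apply/centsP=> a _ b _; apply: GRing.addrC.
rewrite (MhoEabelian 1 ZxZ_pgroup abG).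
rewrite (_ : _ @: _ = setX 'Mho^1([set: 'Z_(p ^ e)]) 'Mho^1([set: 'Z_(p ^ t)])).
  rewrite cardsX !card_Mho_Zpe // -expnD; congr (p ^ _)%N.
  by case: e t e_gt0 t_gt0 => [|e'] [|t'] //= _ _; rewrite addSn addnS !subSS subn0.
apply/setP=> -[a b]; rewrite inE /= !MhoZ //; apply/imsetP/andP.
  by case=> x _; rewrite pow2 => -[-> ->]; split; apply/imsetP; [exists x.1 | exists x.2].
case=> /imsetP[c _ ->] /imsetP[d _ ->]; exists (c, d); first by rewrite inE.
by rewrite pow2.
Qed.

End ZxZ.

Theorem theorem5p1 (p e t : nat) (p_pr : prime p)
    (e_gt0 : (1 <= e)%N) (t_gt0 : (1 <= t)%N) :
  let G := ZxZ p e t in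
  let m := totient (p ^ (e + t - 1)) in
  [/\ isolated (Gamma G) = 'Phi([set: G])%g,
      regular (Delta G) (p * m)%N,
      complete_multipartite (Delta G) (p + 1)%N,
      isomorphic (Delta G) (Kpart (p + 1) m)
    & (#|edges (Delta G)|%:R
        = 2%:R^-1 * p%:R * (p%:R + 1) * m%:R ^+ 2 :> rat)%R].
Proof.
move=> G m.
have pG := ZxZ_pgroup p_pr e_gt0 t_gt0.
have cardPhi := card_Phi_ZxZ p_pr e_gt0 t_gt0.
have le2 : (2 <= e + t)%N by rewrite (leq_add e_gt0 t_gt0).
have cardG : #|[set: G]| = (p ^ 2 * #|'Phi([set: G])%g|)%N.
  by rewrite card_ZxZ // cardPhi -expnD subnKC.
(* The totient of [p ^ (e + t - 1)] is [p.-1 * p ^ (e + t - 2)], which is the size of a fiber. *)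
have defm : m = (p.-1 * #|'Phi([set: G])%g|)%N.
  by rewrite /m totient_pfactor ?subn_gt0 // cardPhi -[_.-1 in X in (_ * X)%N]subn1 -subnDA.
have m_gt0 : (0 < m)%N by rewrite totient_gt0 expn_gt0 prime_gt0.
have adjP := Delta_adjE p_pr pG cardG.
have fibP := Delta_fiber p_pr pG cardG; rewrite -defm in fibP.
have cardD : #|Delta G| = ((p + 1) * m)%N.
  by rewrite (card_Delta p_pr pG cardG) -defm addn1.
have regD : regular (Delta G) (p * m)%N.
  by have := label_regular adjP fibP cardD; rewrite addn1.
split=> //.
- exact: isolated_Phi p_pr pG cardG.
- exact: label_multipartite adjP fibP m_gt0 cardD.
- exact: label_isomorphic adjP fibP m_gt0 cardD.
(* Regularity turns the degree sum into vertices times degree; the factor 2 is then cancelled in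
   [rat]. *)
have : (#|edges (Delta G)| * 2 = (p + 1) * m * (p * m))%N.
  by rewrite handshake (eq_bigr _ (fun x _ => regD x)) sum_nat_const cardD.
move/(congr1 (fun n => n%:R : rat)); rewrite !GRing.natrM GRing.natrD => dbl.
apply: (@GRing.mulIf _ 2%:R) => //; rewrite dbl.
by field.
Qed.
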